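(* Let $\alpha>0$, let $\rho>0$ and put $b=1/\rho$. Let $\{Y(t),t\ge 0\}$ be a stationary extremal process, let $X_0\stackrel{d}{=}Y(1)$, and consider the max-autoregressive scheme $$X_n=\rho X_{n-1}\vee\varepsilon_n,\qquad n>0 \text{ integer},$$ where $\{\varepsilon_n\}$ is an innovation sequence of i.i.d. random variables with $\varepsilon_n\stackrel{d}{=}\rho\,Y(b^{\alpha}-1)$ for all $n$. Then this scheme is marginally stationary with Frechet type max-stable marginals if $\{Y(t)\}$ is $\frac1\alpha$-selfsimilar. Conversely, $\{Y(t)\}$ is $\frac1\alpha$-selfsimilar and the marginals are Frechet type max-stable if this scheme is marginally stationary.
   Context: All random variables are real-valued; $x\vee y=\max(x,y)$, and $\stackrel{d}{=}$ denotes equality in distribution. The innovation $\varepsilon_n$ is independent of $X_{n-1}$. An extremal process is a process $\{Y(t),t\ge 0\}$ with increasing right-continuous sample paths and independent max-increments; its univariate marginals determine its finite-dimensional distributions. It is called stationary if its max-increments are stationary; the univariate marginals are then $P(Y(t)\le u)=\{G(u)\}^{t}$, where $G$ is the distribution function of $Y(1)$. A non-degenerate distribution function $F$ is Frechet type max-stable if $F(x)=\exp\{-k x^{-\alpha}\}$ for $x>0$, where $\alpha>0$ and $k>0$ is a constant. For $H\in\mathbf{R}$, the extremal process $\{Y(t)\}$ is $H$-selfsimilar if $\{Y(ct)\}\stackrel{d}{=}\{c^{H}Y(t)\}$ for any $c>0$; in terms of $G$ this is equivalent to $\{G(c^{H}u)\}^{ct}=\{G(u)\}^{t}$ for any $c>0$.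 The scheme is marginally stationary if $X_n\stackrel{d}{=}X_{n-1}$ for all integers $n>0$.
   Formalization: Assumes ρ ≤ 1 (else Y(b^α−1) is undefined) and Y(1) non-degenerate (Y ≡ 0 is a counterexample); in the converse the scheme is assumed marginally stationary for every ρ in (0,1], since for one fixed ρ the claim is false (log-periodic G). *)

(* Defs.v *)
From HB Require Import structures.
From mathcomp Require Import all_boot all_order all_algebra.
From mathcomp Require Import all_classical all_reals all_analysis.
Set Implicit Arguments.
Unset Strict Implicit.
Unset Printing Implicit Defensive.
Import Order.TTheory GRing.Theory Num.Theory.
Import numFieldNormedType.Exports.

Local Open Scope classical_set_scope.
Local Open Scope ring_scope.

(* The two laws are compared on measurable sets only: the value of a measure
   on a non-measurable set is unspecified, so an equality of the set functions
   [distribution P1 X1] and [distribution P2 X2] would be too strong. *)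
Definition eq_dist (R : realType)
    (d1 : measure_display) (T1 : measurableType d1) (P1 : probability T1 R)
    (d2 : measure_display) (T2 : measurableType d2) (P2 : probability T2 R)
    (d : measure_display) (E : measurableType d)
    (X1 : T1 -> E) (X2 : T2 -> E) : Prop :=
  forall A : set E, measurable A -> P1 (X1 @^-1` A) = P2 (X2 @^-1` A).

Definition independent2 (R : realType) (d : measure_display)
    (T : measurableType d) (P : probability T R) (X Y : {RV P >-> R}) : Prop :=
  forall A B : set R, measurable A -> measurable B ->
    P (X @^-1` A `&` Y @^-1` B) = (P (X @^-1` A) * P (Y @^-1` B))%E.

Definition independent (R : realType) (d : measure_display)
    (T : measurableType d) (P : probability T R) (I : choiceType)
    (X : I -> {RV P >-> R}) : Prop :=
  forall (J : seq I) (A : I -> set R), uniq J ->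
    (forall i, measurable (A i)) ->
    P (\bigcap_(i in [set` J]) (X i @^-1` A i)) =
    (\prod_(i <- J) P (X i @^-1` A i))%E.

Definition joint (R : realType) (d : measure_display) (T : measurableType d)
    (n : nat) (X : nat -> T -> R) : T -> n.-tuple R :=
  fun w => [tuple X i w | i < n].

(* 0 <= t 0 < t 1 < ... < t (n - 1); the later terms of t are irrelevant. *)
Definition time_points (R : realType) (n : nat) (t : nat -> R) : Prop :=
  0 <= t 0%N /\ (forall i, (i.+1 < n)%N -> t i < t i.+1).

(* U 0, ..., U (n - 1) are independent and act as the max-increments of Y over
   the intervals (0, t 0], (t 0, t 1], ..., (t (n - 2), t (n - 1)]: jointly in
   law, Y (t i) is U 0 \/ ... \/ U i.  They may live on another probability
   space, since the paths of Y need not determine them. *)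
Definition max_increments (R : realType)
    (d : measure_display) (T : measurableType d) (P : probability T R)
    (Y : R -> {RV P >-> R}) (n : nat) (t : nat -> R)
    (d' : measure_display) (T' : measurableType d') (P' : probability T' R)
    (U : nat -> {RV P' >-> R}) : Prop :=
  independent (fun i : 'I_n => U i) /\
  eq_dist P P'
    (joint n (fun i w => Y (t i) w))
    (joint n (fun i w => \big[Num.max/U 0%N w]_(j < i.+1) U j w)).

(* The values of Y at negative times play no role. *)
Definition extremal_process (R : realType)
    (d : measure_display) (T : measurableType d) (P : probability T R)
    (Y : R -> {RV P >-> R}) : Prop :=
  [/\ forall w s t, 0 <= s -> s <= t -> Y s w <= Y t w,
      forall w t, 0 <= t -> (fun s => Y s w) @ t^'+ --> Y t w
    & forall n t, time_points n t ->
        exists (d' : measure_display) (T' : measurableType d')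
               (P' : probability T' R) (U : nat -> {RV P' >-> R}),
          max_increments Y n t U].

(* The law of the max-increment over an interval depends on its length only;
   since the increment over (0, h] has the law of Y h, it is the law of Y h
   with h the length of the interval.  Hence the marginal distribution
   functions F_t of Y satisfy F_(s + h) = F_s F_h. *)
Definition stationary_max_increments (R : realType)
    (d : measure_display) (T : measurableType d) (P : probability T R)
    (Y : R -> {RV P >-> R}) : Prop :=
  forall n t, time_points n t ->
    exists (d' : measure_display) (T' : measurableType d')
           (P' : probability T' R) (U : nat -> {RV P' >-> R}),
      max_increments Y n t U /\
      (forall i, (i < n)%N ->
         eq_dist P' P (U i) (Y (t i - (if i is j.+1 then t j else 0)))).

Definition stationary_extremal_process (R : realType)
    (d : measure_display) (T : measurableType d) (P : probability T R)
    (Y : R -> {RV P >-> R}) : Prop :=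
  extremal_process Y /\ stationary_max_increments Y.

Definition selfsimilar (R : realType)
    (d : measure_display) (T : measurableType d) (P : probability T R)
    (H : R) (Y : R -> {RV P >-> R}) : Prop :=
  forall c : R, 0 < c -> forall n t, time_points n t ->
    eq_dist P P
      (joint n (fun i w => Y (c * t i) w))
      (joint n (fun i w => c `^ H * Y (t i) w)).

Definition nondegenerate_rv (R : realType)
    (d : measure_display) (T : measurableType d) (P : probability T R)
    (X : {RV P >-> R}) : Prop :=
  ~ exists a : R, P (X @^-1` [set a]) = 1%E.

(* The formula forces F to vanish on ]-oo, 0] when F is a distribution
   function, and F is then non-degenerate. *)
Definition frechet_max_stable (R : realType) (alpha : R) (F : R -> \bar R)
    : Prop :=
  exists k : R, 0 < k /\
    forall x : R, 0 < x -> F x = (expR (- (k * x `^ (- alpha))))%:E.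

(* eps n is used for n > 0 only.  The time rho^-1 `^ alpha - 1 is nonnegative
   exactly when rho <= 1 (for alpha, rho > 0). *)
Definition max_autoregressive (R : realType)
    (d : measure_display) (T : measurableType d) (P : probability T R)
    (Y : R -> {RV P >-> R}) (alpha rho : R)
    (d' : measure_display) (T' : measurableType d') (P' : probability T' R)
    (X eps : nat -> {RV P' >-> R}) : Prop :=
  [/\ eq_dist P' P (X 0%N) (Y 1),
      forall n w, X n.+1 w = Num.max (rho * X n w) (eps n.+1 w),
      independent (fun n : nat => eps n.+1),
      forall n, independent2 (X n) (eps n.+1)
    & forall n, eq_dist P' P (eps n.+1)
                  (fun w => rho * Y (rho^-1 `^ alpha - 1) w)].

Definition marginally_stationary (R : realType)
    (d : measure_display) (T : measurableType d) (P : probability T R)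
    (X : nat -> {RV P >-> R}) : Prop :=
  forall n, eq_dist P P (X n.+1) (X n).

(* Main.v *)
Require Import Defs.
From HB Require Import structures.
From mathcomp Require Import all_boot all_order all_algebra.
From mathcomp Require Import all_classical all_reals all_analysis.
From mathcomp Require Import lra.
Set Implicit Arguments.
Unset Strict Implicit.
Unset Printing Implicit Defensive.
Import Order.TTheory GRing.Theory Num.Theory.
Import numFieldNormedType.Exports.

Local Open Scope classical_set_scope.
Local Open Scope ring_scope.

(** Write F_t for the distribution function of Y(t).  Splitting [0, s + h] into
    two independent max-increments gives F_{s+h} = F_s F_h, hence F_t = F_1^t
    for t > 0.  Therefore one step of the scheme sends the law F_1 to
    u |-> F_{rho^-alpha}(u / rho), and the scheme is marginally stationary for
    every rho in (0, 1] iff F_c(c^(1/alpha) u) = F_1(u) for all c >= 1, or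
    equivalently for all c > 0.  This functional equation forces F_1 to vanish
    on the negative axis and to be u |-> F_1(1)^(u^-alpha) on the positive one,
    and Y(0) = 0 a.s. by right-continuity of the paths.  The finite-dimensional
    laws are images of independent increments under running maxima, so the
    scaling of the marginals extends to them. *)

(** * Distribution functions and the laws they determine *)

Section distribution_functions.
Context {R : realType}.

(** Closed rays to the left are the complements of the open rays to the right, a known generator.
    Unlike an arbitrary generator they are stable under intersection, as [eq_dist_df] requires. *)
Lemma measurable_raysE :
  @measurable _ R = <<s [set A : set R | exists x, A = `]-oo, x]%classic] >>.
Proof.
apply: (etrans (measurable_realfun.RGenOInfty.measurableE R)).
rewrite eqEsubset; split.
  apply: smallest_sub; first exact: smallest_sigma_algebra.
  move=> _ [x ->]; rewrite -setCitvl.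
  apply: sigma_algebraC; apply: sub_sigma_algebra; by exists x.
apply: smallest_sub; first exact: smallest_sigma_algebra.
move=> _ [x ->]; rewrite -setCitvr.
by apply: sigma_algebraC; apply: sub_sigma_algebra; exists x.
Qed.

(** Real-valued so that real powers and logarithms apply, and defined on bare functions so that
    maxima and multiples of variables can be inserted directly. *)
Definition df d (T : measurableType d) (P : probability T R) (X : T -> R)
  (u : R) : R := fine (P (X @^-1` `]-oo, u])).

Section properties.
Context d (T : measurableType d) (P : probability T R) (X : T -> R).
Hypothesis mX : measurable_fun setT X.

Lemma measurable_ray u : measurable (X @^-1` `]-oo, u]).
Proof. by rewrite -[X @^-1` _]setTI; apply: mX. Qed.

Lemma dfE u : P (X @^-1` `]-oo, u]) = (df P X u)%:E.
Proof. by rewrite /df fineK// fin_num_measure//; exact: measurable_ray. Qed.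

Lemma df_ge0 u : 0 <= df P X u.
Proof. exact: fine_ge0. Qed.

Lemma df_le1 u : df P X u <= 1.
Proof. by rewrite -lee_fin -dfE; apply: probability_le1; exact: measurable_ray. Qed.

Lemma df_nondecreasing u v : u <= v -> df P X u <= df P X v.
Proof.
move=> uv; rewrite -lee_fin -!dfE; apply: le_measure; rewrite ?inE; try exact: measurable_ray.
by move=> w /=; rewrite !in_itv/= => /le_trans; apply.
Qed.

Lemma negligible_ray u : df P X u = 0 -> P.-negligible (X @^-1` `]-oo, u]).
Proof.
move=> Xu; exists (X @^-1` `]-oo, u]); split => //; first exact: measurable_ray.
by apply: (etrans (dfE u)); rewrite Xu.
Qed.

Lemma negligible_setC_ray u :
  df P X u = 1 -> P.-negligible (~` (X @^-1` `]-oo, u])).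
Proof.
move=> Xu; exists (~` (X @^-1` `]-oo, u])).
have mXu := measurable_ray u; split => //; first exact: measurableC.
by apply: (etrans (probability_setC P mXu)); rewrite dfE Xu subee.
Qed.

End properties.

(** The rays form a generating pi-system and exhaust the line, so two finite measures that agree on
    them are equal. *)
Lemma eq_dist_df
    d1 (T1 : measurableType d1) (P1 : probability T1 R)
    d2 (T2 : measurableType d2) (P2 : probability T2 R)
    (X1 : T1 -> R) (X2 : T2 -> R) :
  measurable_fun setT X1 -> measurable_fun setT X2 ->
  df P1 X1 =1 df P2 X2 -> eq_dist P1 P2 X1 X2.
Proof.
move=> mX1 mX2 X12 A mA.
pose Z1 : {mfun T1 >-> R} := HB.pack X1 (isMeasurableFun.Build _ _ _ _ _ mX1).
pose Z2 : {mfun T2 >-> R} := HB.pack X2 (isMeasurableFun.Build _ _ _ _ _ mX2).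
apply: (@measure_unique _ R R [set A : set R | exists x, A = `]-oo, x]%classic]
  (fun n => `]-oo, n%:R]%classic) measurable_raysE _ _ _
  (distribution P1 Z1) (distribution P2 Z2)) => //.
- move=> _ _ [x ->] [y ->]; exists (Num.min x y).
  by apply/seteqP; split => z /=; rewrite !in_itv/= le_min => /andP.
- by move=> i; exists i%:R.
- rewrite -subTset => x _; exists (Num.truncn x).+1 => //=.
  by rewrite in_itv/= ltW// truncnS_gt.
- by move=> _ [x ->]; rewrite -[LHS]/(P1 (X1 @^-1` _)) -[RHS]/(P2 (X2 @^-1` _)) !dfE// X12.
- by move=> k; rewrite -[ltLHS]/(P1 (X1 @^-1` _)) dfE// ltry.
Qed.

Lemma df_eq_dist
    d1 (T1 : measurableType d1) (P1 : probability T1 R)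
    d2 (T2 : measurableType d2) (P2 : probability T2 R)
    (X1 : T1 -> R) (X2 : T2 -> R) :
  eq_dist P1 P2 X1 X2 -> df P1 X1 =1 df P2 X2.
Proof. by move=> X12 u; rewrite /df X12. Qed.

End distribution_functions.

(** * Calculus of equality in distribution *)

Section equality_in_distribution.
Context {R : realType}.
Context d1 (T1 : measurableType d1) (P1 : probability T1 R).
Context d2 (T2 : measurableType d2) (P2 : probability T2 R).
Context d3 (T3 : measurableType d3) (P3 : probability T3 R).
Context d (E : measurableType d).

Lemma eq_dist_sym (X1 : T1 -> E) (X2 : T2 -> E) :
  eq_dist P1 P2 X1 X2 -> eq_dist P2 P1 X2 X1.
Proof. by move=> X12 A mA; rewrite X12. Qed.

Lemma eq_dist_trans (X1 : T1 -> E) (X2 : T2 -> E) (X3 : T3 -> E) :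
  eq_dist P1 P2 X1 X2 -> eq_dist P2 P3 X2 X3 -> eq_dist P1 P3 X1 X3.
Proof. by move=> X12 X23 A mA; rewrite X12// X23. Qed.

Lemma eq_dist_comp d' (E' : measurableType d') (g : E -> E')
    (X1 : T1 -> E) (X2 : T2 -> E) :
  measurable_fun setT g -> eq_dist P1 P2 X1 X2 ->
  eq_dist P1 P2 (g \o X1) (g \o X2).
Proof.
move=> mg X12 A mA; apply: (X12 (g @^-1` A)).
by rewrite -[g @^-1` A]setTI; apply: mg.
Qed.

End equality_in_distribution.

(** * Joint laws of independent variables *)

Section joint_laws.
Context {R : realType} (n : nat).

(** Measurable rectangles: the pi-system used to identify laws on tuples. *)
Definition boxes : set (set (n.-tuple R)) :=
  [set A | exists2 B : 'I_n -> set R, (forall i, measurable (B i)) &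
           A = [set x | forall i, B i (tnth x i)]].

Lemma measurable_boxesE : @measurable _ (n.-tuple R) = <<s boxes >>.
Proof.
rewrite eqEsubset; split.
  apply: smallest_sub; first exact: smallest_sigma_algebra.
  rewrite -bigcup_seq => A [i _ [B mB <-]].
  apply: sub_sigma_algebra; exists (fun j => if j == i then B else setT).
    by move=> j; case: ifP.
  apply/seteqP; split => x /=; first by move=> [_ Bx] j; case: eqP => // ->.
  by move=> /(_ i); rewrite eqxx.
apply: smallest_sub; first exact: sigma_algebra_measurable.
move=> _ [B mB ->].
rewrite [X in measurable X](_ : _ = \bigcap_(i in [set: 'I_n])
    ((@tnth n R) ^~ i @^-1` B i)).
  apply: fin_bigcap_measurable => // i _.
  by rewrite -[_ @^-1` _]setTI; apply: measurable_tnth.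
by apply/seteqP; split => x /= Bx i; [move=> _|]; exact: Bx.
Qed.

Lemma measurable_joint d (T : measurableType d) (X : nat -> T -> R) :
  (forall i, measurable_fun setT (X i)) -> measurable_fun setT (joint n X).
Proof.
move=> mX; apply/measurable_fun_tnthP => i.
rewrite [X in measurable_fun _ X](_ : _ = X i)//.
by apply/funext => w /=; rewrite tnth_mktuple.
Qed.

(** On a box both laws factor into marginal probabilities, [g] being absorbed into the sides of the
    box as a preimage; uniqueness on the pi-system of boxes concludes. *)
Lemma eq_dist_joint_comp
    d1 (T1 : measurableType d1) (P1 : probability T1 R)
    d2 (T2 : measurableType d2) (P2 : probability T2 R)
    (U : nat -> {RV P1 >-> R}) (V : nat -> {RV P2 >-> R}) (g : R -> R) :
  measurable_fun setT g ->
  independent (fun i : 'I_n => U i) -> independent (fun i : 'I_n => V i) ->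
  (forall i, (i < n)%N -> eq_dist P1 P2 (U i) (g \o V i)) ->
  eq_dist P1 P2 (joint n (fun i => U i : T1 -> R)) (joint n (fun i => g \o V i)).
Proof.
move=> mg indU indV UV.
have mgV i : measurable_fun setT (g \o V i) by exact: measurableT_comp.
have mU i : measurable_fun setT (U i) by [].
pose Z1 : {mfun T1 >-> n.-tuple R} := HB.pack (joint n (fun i => U i : T1 -> R))
  (isMeasurableFun.Build _ _ _ _ _ (measurable_joint mU)).
pose Z2 : {mfun T2 >-> n.-tuple R} := HB.pack (joint n (fun i => g \o V i))
  (isMeasurableFun.Build _ _ _ _ _ (measurable_joint mgV)).
move=> A mA.
apply: (@measure_unique _ R (n.-tuple R) boxes (fun=> setT) measurable_boxesE
  _ _ _ (distribution P1 Z1) (distribution P2 Z2)) => //.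
- move=> _ _ [B mB ->] [C mC ->]; exists (fun i => B i `&` C i).
    by move=> i; exact: measurableI.
  apply/seteqP; split => x /=; first by move=> [Bx Cx] i; split.
  by move=> BCx; split => i; case: (BCx i).
- by move=> _; exists (fun=> setT) => //; apply/seteqP; split.
- by apply/seteqP; split => // x _; exists 0%N.
- move=> _ [B mB ->].
  rewrite -[LHS]/(P1 (joint n (fun i => U i : T1 -> R) @^-1` _)).
  rewrite -[RHS]/(P2 (joint n (fun i => g \o V i) @^-1` _)).
  have mgB i : measurable (g @^-1` B i) by rewrite -[_ @^-1` _]setTI; apply: mg.
  transitivity (P1 (\bigcap_(i in [set` enum 'I_n]) (U i @^-1` B i))).
    congr (P1 _); apply/seteqP; split => w /= Bw i.
      by move=> _; have := Bw i; rewrite tnth_mktuple.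
    by rewrite tnth_mktuple; apply: Bw; rewrite /= mem_enum.
  rewrite indU ?enum_uniq//.
  transitivity (\prod_(i <- enum 'I_n) P2 (V i @^-1` (g @^-1` B i)))%E.
    by apply: eq_bigr => i _; rewrite UV.
  rewrite -(indV _ (fun i => g @^-1` B i)) ?enum_uniq//.
  congr (P2 _); apply/seteqP; split => w /= Bw i.
    by rewrite tnth_mktuple; apply: Bw; rewrite /= mem_enum.
  by move=> _; have := Bw i; rewrite tnth_mktuple.
- by move=> k; rewrite -[ltLHS]/(P1 setT) probability_setT ltry.
Qed.

End joint_laws.

(** * Functional equations on the real line *)

Section real_analysis.
Context {R : realType}.
Implicit Types (f G : R -> R) (alpha : R).

Lemma multiplicative_natmul f : (forall s h, 0 <= s -> 0 < h -> f (s + h) = f s * f h) ->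
  forall t n, 0 < t -> f (t *+ n.+1) = f t ^+ n.+1.
Proof.
move=> fM t n t0; elim: n => [|n IH]; first by rewrite mulr1n expr1.
by rewrite mulrS addrC fM ?IH -?exprSr// mulrn_wge0// ltW.
Qed.

Lemma multiplicative_powR f :
  (forall t, 0 <= t -> 0 <= f t <= 1) ->
  (forall s h, 0 <= s -> 0 < h -> f (s + h) = f s * f h) ->
  forall t, 0 < t -> f t = f 1 `^ t.
Proof.
move=> f01 fM t t0.
have fle s u : 0 <= s -> s <= u -> f u <= f s.
  move=> s0; rewrite le_eqVlt => /predU1P[->//|su].
  have u0 : 0 <= u - s by rewrite subr_ge0 ltW.
  rewrite -(subrKC s u) fM ?subr_gt0// ler_piMr//; first by case/andP: (f01 _ s0).
  by case/andP: (f01 _ u0).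
have fX := multiplicative_natmul fM.
have [f10|f1N0] := eqVneq (f 1) 0.
  rewrite f10 powR0 ?gt_eqF//.
  (* This choice gives 1/(N+1) < t; since [f] vanishes at 1/(N+1), monotonicity makes it vanish at
     [t]. *)
  pose N := Num.truncn t^-1.
  have N0 : 0 < N.+1%:R^-1 :> R by rewrite invr_gt0.
  have : f N.+1%:R^-1 ^+ N.+1 = 0.
    by rewrite -fX// -(mulr_natr N.+1%:R^-1) mulVf// pnatr_eq0.
  move/eqP; rewrite expf_eq0/= => /eqP fN0.
  apply/le_anti/andP; split; last by case/andP: (f01 _ (ltW t0)).
  rewrite -fN0 fle ?ltW//.
  by rewrite invf_plt ?posrE// truncnS_gt.
have f1 : 0 < f 1 by rewrite lt_neqAle eq_sym f1N0; case/andP: (f01 1 ler01).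
have f1X n : 0 < f n.+1%:R by rewrite fX// exprn_gt0.
have fpos s : 0 <= s -> 0 < f s.
  move=> s0; apply: (lt_le_trans (f1X (Num.truncn s))); apply: fle => //.
  by apply/ltW/truncnS_gt.
have ft := fpos _ (ltW t0).
pose L := - ln (f 1).
have L0 : 0 <= L by rewrite oppr_ge0 ln_le0//; case/andP: (f01 1 ler01).
suff : ln (f t) + t * L = 0.
  move/eqP; rewrite addr_eq0 => /eqP e.
  by rewrite /powR (negPf f1N0) -[LHS]lnK ?posrE// e /L mulrN opprK.
(* f (n t) lies between f 1 ^ (m + 1) and f 1 ^ m, where m is the integer part
   of n t. *)
have bnd n : `|ln (f t) + t * L| *+ n.+1 <= L.
  rewrite -normrMn mulrnDl -lnXn// -fX// -mulrnAl.
  set s := t *+ n.+1; have s0 : 0 <= s by rewrite mulrn_wge0// ltW.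
  have /andP[ms sm] := truncn_itv s0; set m := Num.truncn s in ms sm.
  have fm k : ln (f k%:R) + k%:R * L = 0.
    case: k => [|k]; last by rewrite fX// lnXn// /L mulrN mulr_natl subrr.
    have -> : f 0 = 1 by apply: (mulIf f1N0); rewrite -fM ?add0r ?mul1r.
    by rewrite ln1 mul0r addr0.
  have lo : ln (f m.+1%:R) <= ln (f s).
    by rewrite ler_ln ?posrE ?fpos//; apply: fle => //; exact: ltW.
  have hi : ln (f s) <= ln (f m%:R).
    by rewrite ler_ln ?posrE ?fpos//; apply: fle.
  have mL : m%:R * L <= s * L by rewrite ler_wpM2r.
  have ML : s * L <= m.+1%:R * L by rewrite ler_wpM2r// ltW.
  have := fm m.+1; have := fm m; move: lo hi mL ML; rewrite -natr1 mulrDl mul1r.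
  by move=> *; rewrite ler_norml; apply/andP; split; lra.
(* A number all of whose multiples are bounded by [L] is zero, by the Archimedean property. *)
apply/eqP; rewrite -normr_eq0; apply/negPn/negP => x0.
have {x0} x0 : 0 < `|ln (f t) + t * L| by rewrite lt_def x0 normr_ge0.
move: x0 bnd; set x := `|_| => x0 bnd.
have := bnd (Num.truncn (L / x)); apply/negP; rewrite -ltNge.
by rewrite -mulr_natl -ltr_pdivrMr// truncnS_gt.
Qed.

(** Taking c = u^alpha gives G(u v) = G(v)^(u^-alpha), so [G] is determined on each open half-line
    by its value at 1 or -1. The limits at infinity force G(-1) = 0 and G(1) > 0, and non-degeneracy
    forces G(1) < 1. *)
Lemma max_stable_df alpha G : 0 < alpha ->
  (forall u, 0 <= G u <= 1) ->
  {homo G : u v / u <= v} ->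
  G @ +oo --> (1 : R) -> G @ -oo --> (0 : R) ->
  ~ ((forall u, u < 0 -> G u = 0) /\ (forall u, 0 < u -> G u = 1)) ->
  (forall c u, 0 < c -> G (c `^ alpha^-1 * u) `^ c = G u) ->
  (forall u, u < 0 -> G u = 0) /\
  exists2 k, 0 < k & forall u, 0 < u -> G u = expR (- (k * u `^ (- alpha))).
Proof.
move=> a0 G01 Gnd Gy GNy nondeg Gs.
have G0 u : 0 <= G u by case/andP: (G01 u).
have G1 u : G u <= 1 by case/andP: (G01 u).
have Gu u v : 0 < u -> G (u * v) = G v `^ (u `^ (- alpha)).
  move=> u0; have := Gs (u `^ alpha) v; rewrite powR_gt0// => /(_ isT).
  rewrite -powRrM mulfV ?gt_eqF// powRr1 ?ltW// => <-.
  by rewrite -powRrM -powRD ?addrN ?powRr0 ?powRr1// (gt_eqF u0) implybT.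
have GN1 : G (-1) = 0.
  (* otherwise G is bounded below by G (-1) on ]-oo, -1] *)
  have [//|GN0] := eqVneq (G (-1)) 0.
  have GN u : u <= -1 -> G (-1) <= G u.
    move=> u1; have Nu1 : 1 <= - u by rewrite lerNr.
    have -> : u = - u * -1 by rewrite mulrN1 opprK.
    rewrite Gu ?(lt_le_trans ltr01)// -[leLHS]powRr1//.
    apply: ger_powR; first by rewrite lt_def GN0 G0 G1.
    rewrite powRN invf_le1 ?powR_gt0 ?(lt_le_trans ltr01)//.
    by rewrite -(powRr0 (- u)) ler_powR// ltW.
  exfalso; move/negP: GN0; apply; rewrite eq_le G0 andbT.
  apply: (cvgr_to_ge GNy); exists (-1); split => // x x1; exact/GN/ltW.
have Gneg u : u < 0 -> G u = 0.
  by move=> u0; rewrite -(opprK u) -(mulrN1 (- u)) Gu ?oppr_gt0// GN1 powR0// gt_eqF// powR_gt0// oppr_gt0.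
have Gpos u : 0 < u -> G u = G 1 `^ (u `^ (- alpha)).
  by move=> u0; rewrite -Gu// mulr1.
split => //.
have G1_gt0 : 0 < G 1.
  rewrite lt_def G0 andbT; apply/eqP => G10.
  have : (1 : R) <= 0; last by rewrite ler10.
  apply: (cvgr_to_le Gy); exists 0; split => // x x0.
  by rewrite Gpos// G10 powR0// gt_eqF// powR_gt0.
exists (- ln (G 1)).
  rewrite oppr_gt0 ln_lt0// G1_gt0/= lt_neqAle G1 andbT.
  apply/eqP => G1E; apply: nondeg; split => // u u0.
  by rewrite Gpos// G1E powR1.
by move=> u u0; rewrite Gpos// {1}/powR (gt_eqF G1_gt0) -mulNr opprK mulrC.
Qed.

End real_analysis.

(** * Marginals of a stationary extremal process *)

Section extremal_processes.
Context {R : realType} d (T : measurableType d) (P : probability T R).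
Variable Y : R -> {RV P >-> R}.

Lemma df_max d' (T' : measurableType d') (P' : probability T' R)
    (X Z : T' -> R) u : measurable_fun setT X -> measurable_fun setT Z ->
  (forall A B : set R, measurable A -> measurable B ->
    P' (X @^-1` A `&` Z @^-1` B) = (P' (X @^-1` A) * P' (Z @^-1` B))%E) ->
  df P' (fun w => Num.max (X w) (Z w)) u = df P' X u * df P' Z u.
Proof.
move=> mX mZ XZ; apply: EFin_inj; rewrite EFinM -!dfE//; last first.
  exact: measurable_realfun.measurable_maxr.
rewrite -XZ//; congr (P' _); apply/seteqP; split => w /=;
  by rewrite !in_itv/= ge_max => /andP.
Qed.

Lemma df_scale d' (T' : measurableType d') (P' : probability T' R)
    (X : T' -> R) c u : 0 < c -> df P' (fun w => c * X w) (c * u) = df P' X u.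
Proof.
move=> c0; congr (fine (P' _)); apply/seteqP; split => w /=;
  by rewrite !in_itv/= ler_pM2l.
Qed.

Lemma independent_pair d' (T' : measurableType d') (P' : probability T' R)
   (U : nat -> {RV P' >-> R}) : independent (fun i : 'I_2 => U i) ->
  forall A B : set R, measurable A -> measurable B ->
    P' (U 0%N @^-1` A `&` U 1%N @^-1` B) = (P' (U 0%N @^-1` A) * P' (U 1%N @^-1` B))%E.
Proof.
move=> indU A B mA mB.
have := indU [:: ord0; ord_max] (fun i : 'I_2 => if i == ord0 then A else B) isT.
rewrite !big_cons big_nil mule1/= => <-; last by move=> i; case: ifP.
congr (P' _); apply/seteqP; split => w /=.
  move=> [Aw Bw] i /=; rewrite !inE => /orP[/eqP->//|/eqP->//].
by move=> Hw; split; [apply: (Hw ord0)|apply: (Hw ord_max)]; rewrite /= !inE.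
Qed.

Lemma tnth_joint n d' (T' : measurableType d') (X : nat -> T' -> R) (i : 'I_n) :
  (@tnth n R)^~ i \o joint n X = X i.
Proof. by apply/funext => w /=; rewrite tnth_mktuple. Qed.

(** At the times s < s + h, the second coordinate is the maximum of two independent increments with
    the laws of [Y s] and [Y h]. *)
Lemma df_increment s h u : stationary_max_increments Y -> 0 <= s -> 0 < h ->
  df P (Y (s + h)) u = df P (Y s) u * df P (Y h) u.
Proof.
move=> stY s0 h0.
have [|d' [T' [P' [U [[indU UY] eU]]]]] := stY 2%N (fun i => if i is 0%N then s else s + h).
  by split => // -[|[|//]]//= _; rewrite ltrDl.
have eU0 : eq_dist P' P (U 0%N) (Y s) by have := eU 0%N isT; rewrite subr0.
have eU1 : eq_dist P' P (U 1%N) (Y h).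
  by have := eU 1%N isT; rewrite /= addrAC subrr add0r.
rewrite -(df_eq_dist eU0) -(df_eq_dist eU1) -df_max//; last exact: independent_pair.
have := eq_dist_comp (measurable_tnth (ord_max : 'I_2)) UY.
rewrite !tnth_joint => /df_eq_dist ->; congr df; apply/funext => w.
(* The iterated maximum starts from [U 0], which therefore occurs twice and is merged by
   idempotence. *)
by rewrite !big_ord_recl big_ord0/= (maxC (U 1%N w)) maxA maxxx.
Qed.

Hypothesis statY : stationary_extremal_process Y.

Lemma df_powR t u : 0 < t -> df P (Y t) u = df P (Y 1) u `^ t.
Proof.
move=> t0; apply: (multiplicative_powR (f := fun t => df P (Y t) u)) => //.
  by move=> s _; rewrite df_ge0 df_le1.
by move=> s h s0 h0; apply: df_increment => //; case: statY.
Qed.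

(** Cancel F_1(u) in F_1 = F_0 F_1. *)
Lemma df_start_eq1 u : 0 < df P (Y 1) u -> df P (Y 0) u = 1.
Proof.
move=> u0; apply: (mulIf (lt0r_neq0 u0)).
by rewrite -df_increment ?add0r ?mul1r//; case: statY.
Qed.

(** The product formula is silent where F_1 vanishes, so the paths are used: if Y(0) <= u < v,
    right-continuity gives Y(1/(n+1)) <= v for some n, and each of these countably many events is
    null. *)
Lemma df_start_eq0 u v : u < v -> df P (Y 1) v = 0 -> df P (Y 0) u = 0.
Proof.
move=> uv v0.
suff N0 : P.-negligible (Y 0 @^-1` `]-oo, u]).
  by rewrite /df measure_negligible//; exact: measurable_ray.
apply: (@negligibleS _ _ _ _ (\bigcup_n (Y n.+1%:R^-1 @^-1` `]-oo, v]))); last first.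
  by apply: negligible_bigcup => n; apply: negligible_ray; rewrite // df_powR// v0 powR0.
move=> w /=; rewrite in_itv/= => Yu.
have [[_ rcY _] _] := statY.
have /cvgr_lt/(_ _ (le_lt_trans Yu uv))[e /= e0 He] := rcY w 0 (lexx 0).
exists (Num.truncn e^-1) => //=; rewrite in_itv/= ltW//; apply: He => //=.
by rewrite sub0r normrN gtr0_norm// invf_plt ?posrE// truncnS_gt.
Qed.

(** Otherwise the event that [X] is nonzero is covered by countably many null tails beyond 1/(n+1)
    on either side, and [X] is almost surely 0. *)
Lemma df_nondegenerate (X : {RV P >-> R}) : nondegenerate_rv X ->
  ~ ((forall u, u < 0 -> df P X u = 0) /\ (forall u, 0 < u -> df P X u = 1)).
Proof.
move=> nd [Xneg Xpos]; apply: nd; exists 0.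
have mX0 : measurable (X @^-1` [set 0]) by rewrite -[_ @^-1` _]setTI; exact: measurable_funP.
suff N0 : P.-negligible (~` (X @^-1` [set 0])).
  have := probability_setC P mX0; rewrite measure_negligible//; last exact: measurableC.
  by move/esym/eqP; rewrite sube_eq// add0e => /eqP.
apply: (@negligibleS _ _ _ _ (\bigcup_n (X @^-1` `]-oo, - n.+1%:R^-1] `|`
   ~` (X @^-1` `]-oo, n.+1%:R^-1])))); last first.
  apply: negligible_bigcup => n; apply: negligibleU.
    by apply: negligible_ray => //; rewrite Xneg// oppr_lt0.
  by apply: negligible_setC_ray => //; rewrite Xpos.
move=> w /= /eqP Xw.
have Xw0 : 0 < `|X w| by rewrite normr_gt0.
exists (Num.truncn `|X w|^-1) => //; rewrite /= !in_itv/=.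
have : (Num.truncn `|X w|^-1).+1%:R^-1 < `|X w|.
  by rewrite invf_plt ?posrE// truncnS_gt.
move: Xw; rewrite neq_lt => /orP[Xw|Xw].
  by rewrite ltr0_norm// => /ltW; rewrite lerNr; left.
by rewrite gtr0_norm// => ?; right; apply/negP; rewrite -ltNge.
Qed.

Lemma cvg_df_pinfty (X : {RV P >-> R}) : df P X @ +oo --> (1 : R).
Proof. exact: (fine_cvg (cvg_cdfy1 X)). Qed.

Lemma cvg_df_ninfty (X : {RV P >-> R}) : df P X @ -oo --> (0 : R).
Proof. exact: (fine_cvg (cvg_cdfNy0 X)). Qed.

(** * From scaling of the marginals to Frechet laws and selfsimilarity *)

Section marginal_scaling.
Variable alpha : R.
Hypothesis alpha_gt0 : 0 < alpha.
Hypothesis nondegY : nondegenerate_rv (Y 1).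
Hypothesis scaleY :
  forall c u, 0 < c -> df P (Y c) (c `^ alpha^-1 * u) = df P (Y 1) u.

Let df_frechet : (forall u, u < 0 -> df P (Y 1) u = 0) /\
  exists2 k, 0 < k &
    forall u, 0 < u -> df P (Y 1) u = expR (- (k * u `^ (- alpha))).
Proof.
apply: max_stable_df => //.
- by move=> u; rewrite df_ge0 df_le1.
- by move=> u v; exact: df_nondecreasing.
- exact: cvg_df_pinfty.
- exact: cvg_df_ninfty.
- exact: df_nondegenerate.
- by move=> c u c0; rewrite -df_powR// scaleY.
Qed.

Lemma scaling_frechet d' (T' : measurableType d') (P' : probability T' R)
  (X : {RV P' >-> R}) : df P' X =1 df P (Y 1) -> frechet_max_stable alpha (cdf X).
Proof.
move=> XY; have [_ [k k0 Gk]] := df_frechet; exists k; split => // x x0.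
by rewrite -Gk// -XY -dfE.
Qed.

(** For t > 0, raise the relation at time 1 to the power [t]. At t = 0 the Frechet form of F_1 makes
    F_0 equal to 0 on negative and 1 on positive arguments, and a positive factor preserves
    signs. *)
Lemma df_scaling c t u : 0 < c -> 0 <= t ->
  df P (Y (c * t)) (c `^ alpha^-1 * u) = df P (Y t) u.
Proof.
move=> c0; rewrite le_eqVlt => /predU1P[<-|t0]; last first.
  by rewrite mulrC df_powR ?mulr_gt0// mulrC powRrM -df_powR// scaleY// -df_powR.
have [G0 [k k0 Gk]] := df_frechet.
have s0 : 0 < c `^ alpha^-1 by rewrite powR_gt0.
have Y0neg v : v < 0 -> df P (Y 0) v = 0.
  (* [v / 2] lies strictly between [v] and 0, as the strict inequality in [df_start_eq0] demands. *)
  by move=> v0; apply: (@df_start_eq0 v (v / 2)); [lra|apply: G0; lra].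
have Y0pos v : 0 < v -> df P (Y 0) v = 1.
  by move=> v0; apply: df_start_eq1; rewrite Gk// expR_gt0.
rewrite mulr0; have [u0|u0|->] := ltgtP u 0; last by rewrite mulr0.
- by rewrite !Y0neg// pmulr_rlt0.
- by rewrite !Y0pos// mulr_gt0.
Qed.

Lemma scaling_eq_dist c t : 0 < c -> 0 <= t ->
  eq_dist P P (Y (c * t)) (fun w => c `^ alpha^-1 * Y t w).
Proof.
move=> c0 t0; apply: eq_dist_df => //; first exact: measurable_realfun.measurable_funM.
move=> u; have s0 : 0 < c `^ alpha^-1 by rewrite powR_gt0.
by rewrite -(mulVKf (lt0r_neq0 s0) u) df_scaling// df_scale.
Qed.

(** Increments over the dilated intervals are distributed as c^(1/alpha) times the original ones;
    independence extends this to their joint law, and running maxima commute with a nonnegative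
    factor. *)
Lemma scaling_selfsimilar : selfsimilar alpha^-1 Y.
Proof.
move=> c c0 n t tn.
have [t0 tS] := tn.
have tcn : time_points n (fun i => c * t i).
  by split=> [|i ni]; [rewrite mulr_ge0// ltW|rewrite ltr_pM2l// tS].
have [_ incr] := statY.
have [d1 [T1 [P1 [U [[indU YU] eU]]]]] := incr n _ tcn.
have [d2 [T2 [P2 [V [[indV YV] eV]]]]] := incr n _ tn.
pose g (x : R) := c `^ alpha^-1 * x.
have mg : measurable_fun setT g by exact: measurable_realfun.measurable_funM.
have UV i : (i < n)%N -> eq_dist P1 P2 (U i) (g \o V i).
  move=> ni; apply: (eq_dist_trans (eU i ni)).
  (* With h the length of the original interval, the chain is U_i ~ Y(c h) ~ g(Y(h)) ~ g(V_i). *)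
  apply: (@eq_dist_trans R _ _ P _ _ P _ _ P2 _ _ _
    (g \o Y (t i - (if i is j.+1 then t j else 0)))).
    rewrite (_ : _ - _ = c * (t i - (if i is j.+1 then t j else 0))).
      apply: scaling_eq_dist => //; case: i ni => [|i] ni; first by rewrite subr0.
      by rewrite subr_ge0 ltW// tS.
    by case: (i) => [|j]; rewrite mulrBr ?mulr0.
  by apply: eq_dist_comp => //; apply: eq_dist_sym; exact: eV.
(* Recovers the values of the process from its increments; as a measurable map on tuples it
   transports equality of laws. *)
pose runmax (x : n.-tuple R) : n.-tuple R :=
  [tuple \big[Num.max/nth 0 x 0%N]_(j < i.+1) nth 0 x j | i < n].
have mnth i : (i < n)%N -> measurable_fun setT (fun x : n.-tuple R => nth 0 x i).
  move=> ni; rewrite [X in measurable_fun _ X](_ : _ = (@tnth n R)^~ (Ordinal ni)).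
    exact: measurable_tnth.
  by apply/funext => x; rewrite (tnth_nth 0).
have mrunmax : measurable_fun setT runmax.
  apply/measurable_fun_tnthP => i.
  rewrite [X in measurable_fun _ X](_ : _ = fun x : n.-tuple R =>
    \big[Num.max/nth 0 x 0%N]_(j < i.+1) nth 0 x j); last first.
    by apply/funext => x /=; rewrite tnth_mktuple.
  have n0 : (0 < n)%N by apply: leq_ltn_trans (ltn_ord i).
  (* The bound is carried through the induction over the index list, so that every [nth] met is a
     genuine, hence measurable, coordinate. *)
  have : all (fun j : 'I_i.+1 => (j < n)%N) (index_enum 'I_i.+1).
    by apply/allP => j _; apply: (leq_trans (ltn_ord j)).
  elim: (index_enum _) => [_|j s IH /= /andP[jn sn]].
    by under eq_fun do rewrite big_nil; exact: mnth.
  under eq_fun do rewrite big_cons.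
  by apply: measurable_realfun.measurable_maxr; [exact: mnth|exact: IH].
pose gg (x : n.-tuple R) : n.-tuple R := [tuple g (tnth x i) | i < n].
have mgg : measurable_fun setT gg.
  apply/measurable_fun_tnthP => i.
  rewrite [X in measurable_fun _ X](_ : _ = g \o (@tnth n R)^~ i).
    by apply: measurableT_comp => //; exact: measurable_tnth.
  by apply/funext => x /=; rewrite tnth_mktuple.
have joint_max d' (T' : measurableType d') (W : nat -> T' -> R) :
    joint n (fun i w => \big[Num.max/W 0%N w]_(j < i.+1) W j w) =
    runmax \o joint n W.
  apply/funext => w; apply: eq_mktuple => i /=.
  have nthW j : (j < n)%N -> nth 0 (joint n W w) j = W j w.
    by move=> jn; rewrite -(tnth_nth 0 _ (Ordinal jn)) tnth_mktuple.
  rewrite nthW; last by apply: leq_ltn_trans (ltn_ord i).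
  by apply: eq_bigr => j _; rewrite nthW//; apply: (leq_trans (ltn_ord j)).
have joint_gg d' (T' : measurableType d') (W : nat -> T' -> R) :
    joint n (fun i => g \o W i) = gg \o joint n W.
  by apply/funext => w; apply: eq_mktuple => i /=; rewrite tnth_mktuple.
apply: (eq_dist_trans YU); rewrite (joint_max _ _ (fun i => U i : T1 -> R)).
apply: (eq_dist_trans (eq_dist_comp mrunmax (eq_dist_joint_comp mg indU indV UV))).
rewrite -(joint_max _ _ (fun i => g \o V i)).
rewrite (joint_gg _ _ (fun i w => Y (t i) w)).
apply: eq_dist_sym; apply: (eq_dist_trans (eq_dist_comp mgg YV)).
rewrite -joint_gg => A _; congr (P2 (_ @^-1` A)); apply/funext => w.
apply: eq_mktuple => i /=.
have gmax : {morph g : x y / Num.max x y} by move=> x y; rewrite /g maxr_pMr// powR_ge0.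
by rewrite (big_morph g gmax erefl).
Qed.

End marginal_scaling.

(** * Marginal scaling and the max-autoregressive scheme *)

Lemma selfsimilar_scaling alpha : selfsimilar alpha^-1 Y ->
  forall c u, 0 < c -> df P (Y c) (c `^ alpha^-1 * u) = df P (Y 1) u.
Proof.
move=> ssY c u c0.
have t1 : time_points 1 (fun=> 1 : R) by split.
have := eq_dist_comp (measurable_tnth (ord0 : 'I_1)) (ssY c c0 1%N _ t1).
rewrite !tnth_joint mulr1 => /df_eq_dist ->.
by rewrite df_scale// powR_gt0.
Qed.

(** By independence the left side is F_1(u) F_h(u) with h = rho^-alpha - 1, and the two times add up
    to rho^-alpha. *)
Lemma df_autoregressive_step alpha rho d' (T' : measurableType d')
    (P' : probability T' R) (X eps : nat -> {RV P' >-> R}) n :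
  0 < alpha -> 0 < rho <= 1 -> max_autoregressive Y alpha rho X eps ->
  df P' (X n) =1 df P (Y 1) ->
  forall u, df P' (X n.+1) (rho * u) = df P (Y (rho^-1 `^ alpha)) u.
Proof.
move=> a0 /andP[rho0 rho1] [_ XE _ indX epsY] XY u.
have -> : (X n.+1 : T' -> R) = fun w => Num.max (rho * X n w) (eps n.+1 w).
  by apply/funext => w; exact: XE.
have mrho : measurable_fun setT (fun x : R => rho * x).
  exact: measurable_realfun.measurable_funM.
rewrite df_max//; first last.
- move=> A B mA mB; rewrite -(indX n ((fun x => rho * x) @^-1` A) B)//.
  by rewrite -[_ @^-1` _]setTI; exact: mrho.
- exact: measurableT_comp.
(* The innovation time is put first because it is 0 when rho = 1, and [df_increment] admits 0 only
   as its first time. *)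
rewrite df_scale// (df_eq_dist (epsY n)) df_scale// XY mulrC -df_increment//.
- by rewrite subrK.
- by case: statY.
- by rewrite subr_ge0 -(powRr0 rho^-1) ler_powR ?invf_ge1// ltW.
Qed.

Lemma autoregressive_df alpha rho d' (T' : measurableType d')
    (P' : probability T' R) (X eps : nat -> {RV P' >-> R}) :
  0 < alpha -> 0 < rho <= 1 ->
  (forall c u, 0 < c -> df P (Y c) (c `^ alpha^-1 * u) = df P (Y 1) u) ->
  max_autoregressive Y alpha rho X eps ->
  forall n, df P' (X n) =1 df P (Y 1).
Proof.
move=> a0 rho01 scaleY scheme; have /andP[rho0 _] := rho01.
elim=> [|n IH] u; first by case: scheme => /df_eq_dist.
rewrite -(mulVKf (lt0r_neq0 rho0) u) (df_autoregressive_step a0 rho01 scheme IH).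
have rV0 : 0 < rho^-1 by rewrite invr_gt0.
(* With c = rho^-alpha, the factor c^(1/alpha) is 1/rho, which inverts the scaling of the step. *)
rewrite -[RHS](scaleY (rho^-1 `^ alpha)) ?powR_gt0//.
by rewrite -powRrM mulfV ?gt_eqF// powRr1 ?ltW// mulVKf ?gt_eqF.
Qed.

(** Taking rho = c^(-1/alpha) <= 1 handles c >= 1. For c < 1, the case 1/c at the point c^(1/alpha)
    u reads F_1(u)^(1/c) = F_1(c^(1/alpha) u); raise it to the power [c]. *)
Lemma stationary_scaling alpha : 0 < alpha ->
  (forall rho, 0 < rho <= 1 ->
     forall u, df P (Y (rho^-1 `^ alpha)) u = df P (Y 1) (rho * u)) ->
  forall c u, 0 < c -> df P (Y c) (c `^ alpha^-1 * u) = df P (Y 1) u.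
Proof.
move=> a0 st.
have ge1 c u : 1 <= c -> df P (Y c) (c `^ alpha^-1 * u) = df P (Y 1) u.
  move=> c1; have c0 : 0 < c := lt_le_trans ltr01 c1.
  have s0 : 0 < c `^ alpha^-1 by rewrite powR_gt0.
  have s1 : 1 <= c `^ alpha^-1 by rewrite -(powRr0 c) ler_powR// invr_ge0 ltW.
  have := st (c `^ alpha^-1)^-1 _ (c `^ alpha^-1 * u).
  rewrite invrK -powRrM mulVf ?gt_eqF// powRr1 ?(ltW c0)// mulKf ?gt_eqF//; apply.
  by rewrite invr_gt0 s0 invf_le1.
move=> c u c0; have [/ge1//|c1] := leP 1 c.
have s0 : 0 < c `^ alpha^-1 by rewrite powR_gt0.
have := ge1 c^-1 (c `^ alpha^-1 * u).
rewrite invf_ge1// ltW// => /(_ isT).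
have -> : c^-1 `^ alpha^-1 = (c `^ alpha^-1)^-1.
  by rewrite -[c^-1]powR_inv1 ?ltW// -powRrM mulN1r powRN.
rewrite mulKf ?gt_eqF// df_powR ?invr_gt0// => e.
by rewrite df_powR// -e -powRrM mulVf ?gt_eqF// powRr1// df_ge0.
Qed.

End extremal_processes.

Theorem mainTheorem5 (R : realType)
    (d : measure_display) (T : measurableType d) (P : probability T R)
    (Y : R -> {RV P >-> R}) (alpha : R)
    (alpha_gt0 : 0 < alpha)
    (Y_extremal : stationary_extremal_process Y)
    (Y1_nondegenerate : nondegenerate_rv (Y 1)) :
  (selfsimilar (alpha^-1) Y ->
   forall rho : R, 0 < rho <= 1 ->
   forall (d' : measure_display) (T' : measurableType d')
          (P' : probability T' R) (X eps : nat -> {RV P' >-> R}),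
     max_autoregressive Y alpha rho X eps ->
     marginally_stationary X /\
     (forall n, frechet_max_stable alpha (cdf (X n))))
  /\
  (forall (d' : R -> measure_display)
          (T' : forall rho : R, measurableType (d' rho))
          (P' : forall rho : R, probability (T' rho) R)
          (X eps : forall rho : R, nat -> {RV (P' rho) >-> R}),
     (forall rho : R, 0 < rho <= 1 ->
        max_autoregressive Y alpha rho (X rho) (eps rho) /\
        marginally_stationary (X rho)) ->
     selfsimilar (alpha^-1) Y /\
     (forall rho : R, 0 < rho <= 1 ->
        forall n, frechet_max_stable alpha (cdf (X rho n)))).
Proof.
split=> [ssY rho rho01 d' T' P' X eps scheme|d' T' P' X eps schemes].
  have scaleY := selfsimilar_scaling ssY.
  have XY := autoregressive_df Y_extremal alpha_gt0 rho01 scaleY scheme.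
  split=> n; first by apply: eq_dist_df => // u; rewrite !XY.
  exact: (scaling_frechet Y_extremal alpha_gt0 Y1_nondegenerate scaleY (XY n)).
have scaleY : forall c u, 0 < c ->
    df P (Y c) (c `^ alpha^-1 * u) = df P (Y 1) u.
  (* For each rho, equality of the laws of [X 0] and [X 1] is the required functional equation. *)
  apply: (stationary_scaling Y_extremal alpha_gt0) => rho rho01 u.
  have [scheme stX] := schemes rho rho01.
  have [/df_eq_dist X0Y _ _ _ _] := scheme.
  rewrite -(df_autoregressive_step Y_extremal alpha_gt0 rho01 scheme X0Y).
  by rewrite (df_eq_dist (stX 0%N)) X0Y.
split; first exact: (scaling_selfsimilar Y_extremal alpha_gt0 Y1_nondegenerate scaleY).
move=> rho rho01 n; have [scheme _] := schemes rho rho01.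
apply: (scaling_frechet Y_extremal alpha_gt0 Y1_nondegenerate scaleY).
exact: (autoregressive_df Y_extremal alpha_gt0 rho01 scaleY scheme).
Qed.
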